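(* Let $\kappa_1,\kappa_2,g_1,g_2$ be positive integers. Suppose that there exists a cubic $\kappa_1$-connected graph $G_1$ with girth $g_1$ having a unique longest cycle, that there exists a cubic graph $G_2$ with girth $g_2$ having precisely three hamiltonian cycles, and that there is a vertex $u \in V(G_2)$ such that $G_2-u$ is $\kappa_2$-connected. Then there exists an infinite family of (pairwise non-isomorphic) cubic $\min\{\kappa_1,\kappa_2\}$-connected graphs, each with girth at least $\min\{2g_1,g_2\}$ and each having a unique longest cycle.
   Context: All graphs are finite and simple. A graph is cubic if every vertex has degree $3$. The girth of a graph is the length of a shortest cycle in it. A graph has a unique longest cycle if, among all cycles of the graph, exactly one cycle (as a subgraph) has maximum length. A hamiltonian cycle is a cycle passing through every vertex. *)

(* Defs.v *)
From mathcomp Require Import all_boot.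

Set Implicit Arguments.
Unset Strict Implicit.
Unset Printing Implicit Defensive.

Record sgraph := SGraph {
  vertex :> finType;
  adj : rel vertex;
  adj_sym : symmetric adj;
  adj_irrefl : irreflexive adj
}.

Definition sgraph_iso (G H : sgraph) : Prop :=
  exists2 f : G -> H, bijective f & forall x y, adj (f x) (f y) = adj x y.

Definition cubic (G : sgraph) : Prop :=
  forall x : G, #|[set y | adj x y]| = 3.

Section DeleteVertices.
Variables (G : sgraph) (S : {set G}).

Definition del_adj : rel {x : G | x \notin S} :=
  fun x y => adj (val x) (val y).

Lemma del_adj_sym : symmetric del_adj.
Proof. by move=> x y; apply: adj_sym. Qed.

Lemma del_adj_irrefl : irreflexive del_adj.
Proof. by move=> x; apply: adj_irrefl. Qed.

Definition del_vertices : sgraph := SGraph del_adj_sym del_adj_irrefl.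
End DeleteVertices.

Definition connected (G : sgraph) : Prop :=
  forall x y : G, connect (@adj G) x y.

Definition k_connected (k : nat) (G : sgraph) : Prop :=
  k < #|G| /\ forall S : {set G}, #|S| < k -> connected (del_vertices S).

(* A subgraph is given by its vertex set and its edge set, an edge being a
   two-element set of vertices.  Sequences that differ by a rotation or a
   reversal trace out the same subgraph. *)
Definition subgraph (G : sgraph) : Type := ({set G} * {set {set G}})%type.

Definition subgraph_of_seq (G : sgraph) (c : seq G) : subgraph G :=
  ([set x in c], [set [set x; next c x] | x in c]).

(* [ucycle] also accepts sequences of size at most 2, which are not cycles
   of a simple graph. *)
Definition is_cycle (G : sgraph) (C : subgraph G) : Prop :=
  exists c : seq G,
    [/\ 3 <= size c, ucycle (@adj G) c & C = subgraph_of_seq c].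

Definition cycle_length (G : sgraph) (C : subgraph G) : nat := #|C.2|.

Definition has_girth (G : sgraph) (g : nat) : Prop :=
  (exists2 C : subgraph G, is_cycle C & cycle_length C = g) /\
  (forall C : subgraph G, is_cycle C -> g <= cycle_length C).

Definition longest_cycle (G : sgraph) (C : subgraph G) : Prop :=
  is_cycle C /\
  forall D : subgraph G, is_cycle D -> cycle_length D <= cycle_length C.

Definition unique_longest_cycle (G : sgraph) : Prop :=
  exists! C : subgraph G, longest_cycle C.

Definition hamiltonian_cycle (G : sgraph) (C : subgraph G) : Prop :=
  is_cycle C /\ C.1 = [set: G].

Definition num_hamiltonian_cycles (G : sgraph) (n : nat) : Prop :=
  exists s : seq (subgraph G),
    [/\ uniq s, size s = n & forall C, C \in s <-> hamiltonian_cycle C].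

(* Main.v *)
Require Import Defs.
From mathcomp Require Import all_boot zify.

(** Replace every vertex of [G1] by a copy of [G2 - u], the three edges at the vertex
    being attached to the three neighbours of [u].  A cycle of the new graph that is not
    contained in a copy meets each copy at most once, so contracting the copies turns it
    into a cycle of [G1], and contracting everything outside a copy to [u] turns it into
    a cycle of [G2] through [u]; this yields the girth bound.  By Smith's theorem every
    edge of a cubic graph lies on an even number of hamiltonian cycles, hence each edge
    at [u] is missed by exactly one of the three hamiltonian cycles of [G2], and [G2 - u]
    has exactly one hamiltonian path between any two neighbours of [u].  The longest cycle
    of the new graph thus arises from the longest cycle of [G1] by inserting these paths.
    Since the new graph inherits the hypotheses on [G1], the construction can be iterated. *)

Set Implicit Arguments.
Unset Strict Implicit.
Unset Printing Implicit Defensive.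

(** * Finite relations *)

Lemma even_fpf_involution (T : finType) (f : T -> T) (A : {set T}) :
  involutive f -> {in A, forall x, f x \in A /\ f x != x} -> ~~ odd #|A|.
Proof.
move=> fK fA; have f_inj := inv_inj fK.
have <- : fcard f A * 2 = #|A|; last by rewrite oddM andbF.
apply: fcard_order_set => //.
  apply/subsetP=> x /fA[_ fx]; rewrite inE (order_cycle (p := [:: x; f x])) //=.
  - by rewrite fK !eqxx.
  - by rewrite inE eq_sym fx.
  - exact: mem_head.
by apply: intro_closed => [|x _ /eqP<- /fA[]//]; apply: fconnect_sym.
Qed.

Lemma connect_homo (T U : finType) (e : rel T) (e' : rel U) (f : T -> U) :
  (forall x y, e x y -> connect e' (f x) (f y)) ->
  forall x y, connect e x y -> connect e' (f x) (f y).
Proof.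
move=> ef x _ /connectP[p ep ->].
elim: p x ep => [|z p IH] x /=; first by rewrite connect0.
by case/andP=> /ef xz /IH; apply: connect_trans.
Qed.

Lemma set2_eq (T : finType) (x y a b : T) :
  [set x; y] = [set a; b] -> x = a /\ y = b \/ x = b /\ y = a.
Proof.
move=> e.
have: x \in [set a; b] by rewrite -e set21.
have: y \in [set a; b] by rewrite -e set22.
have: a \in [set x; y] by rewrite e set21.
have: b \in [set x; y] by rewrite e set22.
by rewrite !inE; do 4![case/orP=> /eqP ?]; subst; auto.
Qed.

Section Relations.
Variable T : finType.
Implicit Types r : rel T.

Definition nbh r (x : T) : {set T} := [set y | r x y].

Definition supp r : {set T} := [set x | [exists y, r x y]].

Lemma suppP r x : reflect (exists y, r x y) (x \in supp r).
Proof. by rewrite inE; apply: existsP. Qed.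

Lemma mem_supp r x y : r x y -> x \in supp r.
Proof. by move=> rxy; apply/suppP; exists y. Qed.

Lemma supp_nbh r x : (x \in supp r) = (0 < #|nbh r x|).
Proof.
by rewrite card_gt0; apply/suppP/set0Pn=> -[y rxy]; exists y; move: rxy; rewrite inE.
Qed.

Lemma eq_nbh r1 r2 : r1 =2 r2 -> nbh r1 =1 nbh r2.
Proof. by move=> e x; apply/setP=> y; rewrite !inE e. Qed.

Lemma eq_supp r1 r2 : r1 =2 r2 -> supp r1 = supp r2.
Proof. by move=> e; apply/setP=> x; rewrite !supp_nbh (eq_nbh e). Qed.

Lemma handshake r : symmetric r -> irreflexive r -> ~~ odd (\sum_x #|nbh r x|).
Proof.
move=> symr irr.
have -> : \sum_x #|nbh r x| = #|[set p | r p.1 p.2]|.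
  by under eq_bigr do rewrite -sum1dep_card; rewrite pair_big_dep sum1dep_card.
apply: (@even_fpf_involution _ (fun p => (p.2, p.1))) => [[]|[x y]] //.
rewrite !inE /= symr => rxy; split=> //.
by apply: contraTneq rxy => -[-> _]; rewrite irr.
Qed.

Lemma unextendable_path r x : x \in supp r ->
  exists z s, [/\ z \in supp r, path r z s, uniq (z :: s) &
                  forall y, r y z -> y \in z :: s].
Proof.
pose s : seq T := [::]; have px : path r x s by []; have ux : uniq (x :: s) by [].
have [n] := ubnP (#|T| - size s); elim: n x s px ux => // n IH z s pz uz lt_n zr.
have [/existsP[y /andP[ryz ys]]|/existsPn max_z] :=
    boolP [exists y, r y z && (y \notin z :: s)]; last first.
  exists z, s; split=> // y ryz; apply: contraT => ys.
  by have := max_z y; rewrite ryz ys.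
apply: (IH y (z :: s)); rewrite ?(mem_supp ryz) //=; [exact/andP..|].
have := max_card (mem (z :: s)); rewrite (card_uniqP uz) => lt_s.
exact: leq_trans (ltn_sub2l lt_s (ltnSn _)) lt_n.
Qed.

(* In an unextendable path all neighbours of the first vertex lie on the path;
   any of them but the second vertex closes a cycle. *)
Lemma exists_ucycle r : symmetric r -> irreflexive r -> supp r != set0 ->
  {in supp r, forall x, 1 < #|nbh r x|} -> exists2 c, 2 < size c & ucycle r c.
Proof.
move=> symr irr /set0Pn[x /unextendable_path[z [s [zr pz uz max_z]]]] deg.
have [d [s' es]] : exists d s', s = d :: s'.
  case: s pz uz max_z => [|d s'] _ _ max_z; last by exists d, s'.
  have /suppP[y rzy] := zr; have := max_z y; rewrite symr inE => /(_ rzy)/eqP yz.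
  by rewrite yz irr in rzy.
have [b rzb bs'] : exists2 b, r z b & b \in s'.
  have /card_gt0P[b] : 0 < #|nbh r z :\ d|.
    by have := deg z zr; rewrite (cardsD1 d); case: (d \in _) => //= /ltnW.
  rewrite !inE => /andP[bd rzb]; exists b => //.
  have := max_z b; rewrite symr es !inE (negPf bd) => /(_ rzb)/orP[/eqP bz|//].
  by rewrite bz irr in rzb.
case/path.splitP: bs' es => p1 p2 es; rewrite es -!cat_cons cat_uniq in pz uz.
exists (z :: d :: rcons p1 b); first by rewrite /= size_rcons.
move: pz; rewrite cat_path => /andP[pz _]; have /andP[uc _] := uz.
by rewrite /ucycle uc andbT /cycle rcons_path pz /= last_rcons symr.
Qed.

End Relations.

(** * Cycles as connected two-regular relations *)

Record cycle_rel (G : sgraph) (r : rel G) : Prop := CycleRel {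
  cycle_rel_sym : symmetric r;
  cycle_rel_adj : subrel r (@adj G);
  cycle_rel_deg : {in supp r, forall x, #|nbh r x| = 2};
  cycle_rel_neq0 : supp r != set0;
  cycle_rel_connect : {in supp r &, forall x y, connect r x y}
}.

Lemma cycle_rel_sub_eq (G : sgraph) (r s : rel G) :
  cycle_rel r -> cycle_rel s -> subrel s r -> s =2 r.
Proof.
move=> cr cs sub.
have supp_sub x : x \in supp s -> x \in supp r.
  by case/suppP=> y /sub; apply: mem_supp.
have eq_nbh_s x : x \in supp s -> nbh s x = nbh r x.
  move=> xs; apply/eqP; rewrite eqEcard (cycle_rel_deg cs) //.
  rewrite (cycle_rel_deg cr) ?supp_sub // leqnn andbT.
  by apply/subsetP=> y; rewrite !inE => /sub.
have closed_s : closed r (mem (supp s)).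
  apply: intro_closed => [|x y rxy xs]; first exact/sym_connect_sym/cycle_rel_sym.
  have : y \in nbh s x by rewrite eq_nbh_s // inE.
  by rewrite inE (cycle_rel_sym cs); apply: mem_supp.
have /set0Pn[z zs] := cycle_rel_neq0 cs.
move=> x y; apply/idP/idP=> [/sub//|rxy].
have xs : x \in supp s.
  rewrite -(closed_connect closed_s (x := z)) //.
  by apply: (cycle_rel_connect cr); rewrite ?(mem_supp rxy) ?supp_sub.
by have /setP/(_ y) := eq_nbh_s x xs; rewrite !inE rxy.
Qed.

Definition edge_rel (G : sgraph) (C : subgraph G) : rel G :=
  fun x y => [set x; y] \in C.2.

Definition subgraph_of_rel (G : sgraph) (r : rel G) : subgraph G :=
  (supp r, [set [set p.1; p.2] | p in [set p : G * G | r p.1 p.2]]).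

Lemma edge_rel_sym (G : sgraph) (C : subgraph G) : symmetric (edge_rel C).
Proof. by move=> x y; rewrite /edge_rel setUC. Qed.

Lemma edge_relK (G : sgraph) (r : rel G) :
  symmetric r -> edge_rel (subgraph_of_rel r) =2 r.
Proof.
move=> symr x y; apply/imsetP/idP=> [[[a b]]|rxy].
  by rewrite inE /= => rab /set2_eq[] [-> ->] //; rewrite symr.
by exists (x, y); rewrite ?inE.
Qed.

Lemma eq_subgraph_of_rel (G : sgraph) (r1 r2 : rel G) :
  r1 =2 r2 -> subgraph_of_rel r1 = subgraph_of_rel r2.
Proof.
move=> e; rewrite /subgraph_of_rel (eq_supp e).
suff -> : [set p : G * G | r1 p.1 p.2] = [set p | r2 p.1 p.2] by [].
by apply/setP=> p; rewrite !inE e.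
Qed.

Lemma next_head (T : eqType) (x y : T) s : next [:: x, y & s] x = y.
Proof. by rewrite next_nth mem_head /= eqxx. Qed.

Section CycleOfSeq.
Variables (G : sgraph) (c : seq G).
Hypothesis uc : uniq c.
Let C := subgraph_of_seq c.

Lemma edge_rel_seqE x y :
  edge_rel C x y = (x \in c) && ((y == next c x) || (y == prev c x)).
Proof.
apply/imsetP/andP=> [[z zc /set2_eq[] [-> ->]]|[xc /orP[]/eqP->]].
- by rewrite zc eqxx.
- by rewrite mem_next zc prev_next // eqxx orbT.
- by exists x.
- by exists (prev c x); rewrite ?mem_prev ?next_prev // setUC.
Qed.

Lemma supp_edge_rel_seq : supp (edge_rel C) = C.1.
Proof.
apply/setP=> x; rewrite [RHS]inE; apply/suppP/idP=> [[y]|xc].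
  by rewrite edge_rel_seqE => /andP[].
by exists (next c x); rewrite edge_rel_seqE xc eqxx.
Qed.

Lemma cycle_edge_rel_seq : cycle (edge_rel C) c.
Proof.
apply: (@sub_in_cycle _ (mem c) (frel (next c))); last exact: cycle_next.
  by move=> x y xc yc /= /eqP e; rewrite edge_rel_seqE e eqxx andbT; apply: xc.
exact/allP.
Qed.

Lemma card_vertices_seq : #|C.1| = size c.
Proof. by rewrite cardsE; apply/card_uniqP. Qed.

Lemma subgraph_of_edge_rel_seq : subgraph_of_rel (edge_rel C) = C.
Proof.
rewrite /subgraph_of_rel supp_edge_rel_seq [RHS]surjective_pairing; congr (_, _).
apply/setP=> E; apply/imsetP/idP=> [[[x y]]|/imsetP[x xc ->]].
  by rewrite inE => + ->.
by exists (x, next c x); rewrite // inE /= edge_rel_seqE xc eqxx.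
Qed.

Lemma subgraph_of_seq_rot i : subgraph_of_seq (rot i c) = C.
Proof.
congr (_, _); first by apply/setP=> x; rewrite !inE mem_rot.
apply/setP=> E; apply/imsetP/imsetP=> -[x]; rewrite ?mem_rot => xc ->.
  by exists x; rewrite ?next_rot.
by exists x; rewrite ?mem_rot ?next_rot.
Qed.

Lemma subgraph_of_seq_rev : subgraph_of_seq (rev c) = C.
Proof.
congr (_, _); first by apply/setP=> x; rewrite !inE mem_rev.
apply/setP=> E; apply/imsetP/imsetP=> -[x]; rewrite ?mem_rev => xc ->.
  by exists (prev c x); rewrite ?mem_prev // next_rev // next_prev // setUC.
by exists (next c x); rewrite ?mem_rev ?mem_next // next_rev // prev_next // setUC.
Qed.

Hypothesis c_gt2 : 2 < size c.

Lemma next_neq_prev x : x \in c -> next c x != prev c x.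
Proof.
move=> xc; have [i s e] := rot_to xc; apply/eqP=> next_prev_x.
have : next c (next c x) = x by rewrite next_prev_x next_prev.
have : uniq (x :: s) by rewrite -e rot_uniq.
have : 2 < size (x :: s) by rewrite -e size_rot.
rewrite -!(next_rot i uc) e; case: s {e} => [|y [|z s]] // _.
rewrite next_head next_nth !inE eqxx orbT /= !negb_or => /andP[/and3P[xy xz _] _].
by rewrite (negPf xy) eqxx => /= zx; rewrite zx eqxx in xz.
Qed.

Lemma card_edges_seq : #|C.2| = size c.
Proof.
rewrite card_in_imset; first exact/card_uniqP.
move=> x y xc yc /set2_eq[[] //|[ex ey]].
by have := next_neq_prev xc; rewrite {1}ey {1}ex prev_next // eqxx.
Qed.

Lemma cycle_rel_seq : cycle (@adj G) c -> cycle_rel (edge_rel C).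
Proof.
move=> adj_c; split; rewrite ?supp_edge_rel_seq.
- exact: edge_rel_sym.
- move=> x y; rewrite edge_rel_seqE => /andP[xc /orP[]/eqP->].
    exact: next_cycle.
  by rewrite adj_sym; apply: prev_cycle.
- move=> x; rewrite inE => xc.
  rewrite (_ : nbh _ x = [set next c x; prev c x]) ?cards2 ?next_neq_prev //.
  by apply/setP=> y; rewrite !inE edge_rel_seqE xc.
- by rewrite -card_gt0 card_vertices_seq (leq_trans _ c_gt2).
- by move=> x y; rewrite !inE; apply: connect_cycle; apply: cycle_edge_rel_seq.
Qed.

End CycleOfSeq.

Section CycleTheory.
Variable G : sgraph.
Implicit Types (C : subgraph G) (r : rel G).

Lemma is_cycle_edge_rel C : is_cycle C -> cycle_rel (edge_rel C).
Proof. by case=> c [c_gt2 /andP[adj_c uc] ->]; apply: cycle_rel_seq. Qed.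

Lemma is_cycleK C : is_cycle C -> subgraph_of_rel (edge_rel C) = C.
Proof. by case=> c [_ /andP[_ uc] ->]; apply: subgraph_of_edge_rel_seq. Qed.

Lemma supp_edge_rel C : is_cycle C -> supp (edge_rel C) = C.1.
Proof. by case=> c [_ /andP[_ uc] ->]; apply: supp_edge_rel_seq. Qed.

Lemma cycle_lengthE C : is_cycle C -> cycle_length C = #|supp (edge_rel C)|.
Proof.
case=> c [c_gt2 /andP[_ uc] ->]; rewrite supp_edge_rel_seq //.
by rewrite /cycle_length card_edges_seq ?card_vertices_seq.
Qed.

Lemma cycle_length_gt2 C : is_cycle C -> 2 < cycle_length C.
Proof. by case=> c [c_gt2 /andP[_ uc] ->]; rewrite /cycle_length card_edges_seq. Qed.

Lemma is_cycle_subgraph_of_rel r : cycle_rel r -> is_cycle (subgraph_of_rel r).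
Proof.
move=> cr; have symr := cycle_rel_sym cr; have adjr := cycle_rel_adj cr.
have irr : irreflexive r by move=> x; apply/negP=> /adjr; rewrite adj_irrefl.
have [x xr|c c_gt2 /andP[rc uc]] := exists_ucycle symr irr (cycle_rel_neq0 cr).
  by rewrite (cycle_rel_deg cr).
have adj_c : cycle (@adj G) c by apply: sub_cycle rc.
have rE : edge_rel (subgraph_of_seq c) =2 r.
  apply: cycle_rel_sub_eq (cycle_rel_seq uc c_gt2 adj_c) _ => // x y.
  rewrite edge_rel_seqE // => /andP[xc /orP[]/eqP->]; first exact: next_cycle.
  by rewrite symr; apply: prev_cycle.
exists c; split=> //; first exact/andP.
by rewrite -(eq_subgraph_of_rel rE) subgraph_of_edge_rel_seq.
Qed.

Lemma cycle_length_rel r : cycle_rel r -> cycle_length (subgraph_of_rel r) = #|supp r|.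
Proof.
move=> cr; rewrite cycle_lengthE; last exact: is_cycle_subgraph_of_rel.
exact/eq_card/setP/eq_supp/edge_relK/cycle_rel_sym.
Qed.

Lemma cycle_rel_gt2 r : cycle_rel r -> 2 < #|supp r|.
Proof.
move=> cr; rewrite -cycle_length_rel //.
exact/cycle_length_gt2/is_cycle_subgraph_of_rel.
Qed.

Definition girth_ge g := forall C, is_cycle C -> g <= cycle_length C.

Lemma girth_geP g : girth_ge g <-> forall r, cycle_rel r -> g <= #|supp r|.
Proof.
split=> [girth r cr|girth C cycC].
  by rewrite -cycle_length_rel //; apply/girth/is_cycle_subgraph_of_rel.
by rewrite cycle_lengthE //; apply/girth/is_cycle_edge_rel.
Qed.

Lemma unique_longest_cycleP :
  unique_longest_cycle G <->
  exists2 r : rel G, cycle_rel r &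
    forall s : rel G, cycle_rel s -> #|supp r| <= #|supp s| -> s =2 r.
Proof.
split=> [[C [[cycC maxC] uniqC]]|[r cr uniq_r]].
  exists (edge_rel C) => [|s cs le_Cs]; first exact: is_cycle_edge_rel.
  suff -> : C = subgraph_of_rel s.
    by move=> x y; rewrite edge_relK //; apply: cycle_rel_sym.
  apply: uniqC; split=> [|D /maxC le_DC]; first exact: is_cycle_subgraph_of_rel.
  by rewrite cycle_length_rel // (leq_trans le_DC) // cycle_lengthE.
have eq_r D : is_cycle D -> #|supp r| <= cycle_length D -> edge_rel D =2 r.
  by move=> cycD; rewrite cycle_lengthE //; apply/uniq_r/is_cycle_edge_rel.
exists (subgraph_of_rel r); split.
  split=> [|D cycD]; first exact: is_cycle_subgraph_of_rel.
  rewrite cycle_length_rel // leqNgt; apply/negP=> lt_rD.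
  have rD := eq_r D cycD (ltnW lt_rD).
  by rewrite cycle_lengthE // (eq_supp rD) ltnn in lt_rD.
move=> D [cycD maxD]; rewrite -(is_cycleK cycD); apply: eq_subgraph_of_rel => x y.
by rewrite eq_r // -cycle_length_rel //; apply/maxD/is_cycle_subgraph_of_rel.
Qed.

Lemma is_cycle_from_edge C x y : is_cycle C -> edge_rel C x y ->
  exists q, [/\ 2 < size [:: x, y & q], ucycle (@adj G) [:: x, y & q] &
                C = subgraph_of_seq [:: x, y & q]].
Proof.
have from_next c : 2 < size c -> ucycle (@adj G) c -> x \in c -> next c x = y ->
    exists q, [/\ 2 < size [:: x, y & q], ucycle (@adj G) [:: x, y & q] &
                  subgraph_of_seq c = subgraph_of_seq [:: x, y & q]].
  move=> c_gt2 /andP[ac uc] xc; have [i s e] := rot_to xc.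
  rewrite -(next_rot i) // -(subgraph_of_seq_rot uc i) -(size_rot i) in c_gt2 *.
  have : ucycle (@adj G) (rot i c) by rewrite /ucycle rot_cycle rot_uniq ac.
  rewrite e in c_gt2 *; case: s c_gt2 {e} => [|z s] // c_gt2 ? <-.
  by rewrite next_head; exists s.
case=> c [c_gt2 /andP[ac uc] ->]; rewrite edge_rel_seqE // => /andP[xc].
case/orP=> /eqP yx; first by apply: from_next; rewrite // /ucycle ac.
have rev_ac : cycle (@adj G) (rev c).
  by rewrite rev_cycle (eq_cycle (e' := @adj G)) // => a b; apply: adj_sym.
rewrite -subgraph_of_seq_rev //.
by apply: from_next; rewrite ?size_rev ?mem_rev ?next_rev // /ucycle rev_uniq rev_ac.
Qed.

End CycleTheory.

Arguments girth_ge : clear implicits.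

Lemma eq_path_deg2 (T : finType) (r : rel T) x y q q' :
  symmetric r -> (forall z, #|nbh r z| <= 2) -> size q = size q' ->
  path r x (y :: q) -> path r x (y :: q') ->
  uniq [:: x, y & q] -> uniq [:: x, y & q'] -> q = q'.
Proof.
move=> symr deg; elim: q x y q' => [|z q IH] x y [|z' q'] // [eq_size] p p' u u'.
have ezz' : z = z'.
  apply: contraTeq (deg y) => nzz'; rewrite -ltnNge.
  rewrite (_ : 3 = #|[set x; z; z']|).
    apply/subset_leq_card/subsetP=> w; rewrite !inE => /orP[/orP[]|]/eqP->.
    - by case/andP: p; rewrite symr.
    - by case/and3P: p.
    - by case/and3P: p'.
  move: u u'; rewrite /= !inE !negb_or.
  move=> /andP[/and3P[_ xz _] _] /andP[/and3P[_ xz' _] _].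
  by rewrite setUC cardsU1 cards2 !inE negb_or xz ![z' == _]eq_sym xz' nzz'.
rewrite -ezz' in p' u' *; congr (_ :: _).
case/andP: p => _ p; case/andP: p' => _ p'.
by case/andP: u => _ u; case/andP: u' => _ u'; apply: IH p p' u u'.
Qed.

Lemma subgraph_of_seq_inj (G : sgraph) (x y : G) q q' :
  2 < size [:: x, y & q] -> ucycle (@adj G) [:: x, y & q] ->
  ucycle (@adj G) [:: x, y & q'] ->
  subgraph_of_seq [:: x, y & q] = subgraph_of_seq [:: x, y & q'] -> q = q'.
Proof.
move=> size_gt2 /andP[adj_q uq] /andP[_ uq'] e.
set C := subgraph_of_seq _ in e.
have cC : cycle_rel (edge_rel C) by apply: cycle_rel_seq.
have path_of s : cycle (edge_rel C) (x :: s) -> path (edge_rel C) x s.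
  by rewrite /= rcons_path => /andP[].
apply: (@eq_path_deg2 _ (edge_rel C) x y) => //.
- exact: edge_rel_sym.
- move=> z; case: (posnP #|nbh (edge_rel C) z|) => [->//|].
  by rewrite -supp_nbh => /(cycle_rel_deg cC)->.
- have := congr1 (fun D : subgraph G => #|D.1|) e.
  by rewrite !card_vertices_seq // => -[].
- exact/path_of/cycle_edge_rel_seq.
- by apply: path_of; rewrite e; apply: cycle_edge_rel_seq.
Qed.

(** * Hamiltonian cycles through an edge *)

Section Flip.
Variable T : eqType.
Implicit Types p : seq T.

Definition flip i p := take i p ++ rev (drop i p).

Lemma perm_flip i p : perm_eq (flip i p) p.
Proof. by rewrite -[X in perm_eq _ X](cat_take_drop i) perm_cat2l perm_rev. Qed.

Lemma size_flip i p : size (flip i p) = size p.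
Proof. exact/perm_size/perm_flip. Qed.

Lemma nth_flip x0 i p j : i <= size p -> j < size p ->
  nth x0 (flip i p) j = nth x0 p (if j < i then j else size p - j.+1 + i).
Proof.
move=> ip jp; rewrite nth_cat size_takel //; case: ltnP => [ji|ij].
  by rewrite nth_take.
rewrite nth_rev ?size_drop; last by rewrite ltn_sub2r // (leq_ltn_trans ij).
by rewrite nth_drop; congr nth; lia.
Qed.

Lemma flipK i : involutive (flip i).
Proof.
move=> p; have [ip|pi] := leqP i (size p); last first.
  by rewrite /flip !(take_oversize, drop_oversize, cats0) // ltnW.
rewrite /flip take_size_cat ?size_takel // drop_size_cat ?size_takel //.
by rewrite revK cat_take_drop.
Qed.

Lemma flip_tupleP n i (p : n.-tuple T) : size (flip i p) == n.
Proof. by rewrite size_flip size_tuple. Qed.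

Definition flip_tuple n i (p : n.-tuple T) : n.-tuple T := Tuple (flip_tupleP i p).

End Flip.

(* Thomason's lollipop argument: hamiltonian paths starting with the edge [x y]
   whose last vertex is adjacent to an inner vertex are paired by adding that
   edge and deleting the one that follows it on the path.  The last vertex of a
   path in [lollipops j] is adjacent to the [j]-th one, so that [lollipops 0]
   corresponds to the hamiltonian cycles through [x y]. *)
Section Lollipops.
Variables (G : sgraph) (m : nat) (x y : G).
Hypotheses (odd_deg : forall z : G, odd #|nbh (@adj G) z|) (cardG : #|G| = m.+3).
Implicit Types p : m.+3.-tuple G.

Definition ham_path (p : seq G) :=
  [&& uniq p, sorted (@adj G) p, nth x p 0 == x & nth x p 1 == y].

Definition chord (p : seq G) j := adj (nth x p j) (nth x p m.+2).

Definition lollipops j := [set p : m.+3.-tuple G | ham_path p && chord p j].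

Lemma ham_path_flip i p : 1 < i < m.+2 -> chord p i.-1 ->
  ham_path p -> ham_path (flip i p).
Proof.
case/andP=> i1 im ai /and4P[up /(sortedP x) adjp p0 p1]; have size_p := size_tuple p.
have szi : i <= m.+3 by lia.
apply/and4P; split; rewrite ?nth_flip ?size_p ?i1 ?(ltnW i1) //.
  by rewrite (perm_uniq (perm_flip i p)).
apply/(sortedP x) => j; rewrite size_flip size_p => jm.
rewrite !nth_flip ?size_p ?(ltnW jm) //.
have [ji|ij] := ltnP j.+1 i; first by rewrite (ltnW ji) adjp ?size_p.
have [ji|ij'] := ltnP j i.
  have -> : j = i.-1 by lia.
  by rewrite (_ : _ - _ + _ = m.+2) //; lia.
rewrite adj_sym (_ : m.+3 - j.+1 + i = (m.+3 - j.+2 + i).+1); last by lia.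
by apply: adjp; rewrite size_p; lia.
Qed.

Lemma even_lollipops i : 0 < i < m.+1 -> ~~ odd #|lollipops i|.
Proof.
case: i => // i im; set k := i.+2.
apply: (@even_fpf_involution _ (flip_tuple k)) => [p|p].
  by apply/val_inj; rewrite /= flipK.
rewrite !inE => /andP[hp ch]; have size_p := size_tuple p.
have szk : k <= m.+3 by rewrite /k; lia.
have /and4P[up /(sortedP x) adjp _ _] := hp.
have nth_k : nth x (flip k p) k.-1 = nth x p k.-1.
  by rewrite nth_flip ?size_p ?ifT //; lia.
have nth_end : nth x (flip k p) m.+2 = nth x p k.
  by rewrite nth_flip ?size_p ?ifF //; [congr nth; lia|lia].
split.
  by rewrite ham_path_flip //= /chord nth_k nth_end adjp ?size_p //; lia.
apply/eqP=> /(congr1 (fun q : m.+3.-tuple G => nth x q m.+2)) /=.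
by rewrite nth_end => /eqP; rewrite nth_uniq ?size_p //; lia.
Qed.

Lemma even_chords p : ham_path p -> ~~ odd (\sum_(0 <= j < m.+1) chord p j).
Proof.
case/and4P=> up /(sortedP x) adjp _ _; have size_p := size_tuple p.
set z := nth x p m.+2.
have mem_p w : w \in p.
  have /subset_cardP: #|p| = #|G| by rewrite (card_uniqP up) size_p.
  by move/(_ (subset_predT _)) => ->.
have : odd (\sum_(0 <= j < m.+3) adj (nth x p j) z).
  rewrite (_ : \sum_(_ <= _ < _) _ = #|nbh (@adj G) z|) // -sum1dep_card.
  transitivity (\sum_(w <- p) adj w z); first by rewrite (big_nth x) size_p.
  rewrite big_uniq //= [RHS]big_mkcond; apply: eq_big => w; first by rewrite mem_p.
  by rewrite adj_sym; case: ifP.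
rewrite (big_nat_recr m.+2) // (big_nat_recr m.+1) //= adj_irrefl addn0.
by rewrite adjp ?size_p // addn1.
Qed.

Lemma even_lollipops0 : ~~ odd #|lollipops 0|.
Proof.
have : ~~ odd (\sum_(0 <= j < m.+1) #|lollipops j|).
  under eq_bigr do rewrite -sum1dep_card big_mkcondr.
  rewrite exchange_big -dvdn2; apply: dvdn_sum => p hp.
  rewrite dvdn2 (_ : \sum_(_ <= _ < _) _ = \sum_(0 <= j < m.+1) chord p j).
    exact: even_chords.
  by apply: eq_bigr => j _; case: ifP.
rewrite big_nat_recl // oddD (negPf (_ : ~~ odd (\sum_(_ <= _ < _) _))) ?addbF //.
rewrite -dvdn2 big_nat; apply: dvdn_sum => i /andP[_ im].
by rewrite dvdn2; apply: even_lollipops.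
Qed.

Lemma lollipops_ucycle p : p \in lollipops 0 ->
  exists2 q, val p = [:: x, y & q] & ucycle (@adj G) p.
Proof.
rewrite inE /chord => /andP[/and4P[up sp p0 p1]]; have size_p := size_tuple p.
have <- : last x p = nth x p m.+2 by rewrite -nth_last size_p.
rewrite (eqP p0); case: p size_p up sp p0 p1 => -[|a [|b q]] //= _ _.
move=> up sp /eqP ax /eqP b_y adj_last; rewrite ax b_y in up sp adj_last *.
exists q => //; apply/andP; split; last exact: up.
by rewrite -[cycle _ _]/(path _ x (rcons (y :: q) x)) rcons_path adj_sym; apply/andP.
Qed.

Lemma hamiltonian_cycle_lollipop C : hamiltonian_cycle C -> edge_rel C x y ->
  exists2 p, p \in lollipops 0 & C = subgraph_of_seq p.
Proof.
case=> cycC C_full rC; have [q [_ /andP[adj_q uq] eC]] := is_cycle_from_edge cycC rC.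
have size_p : size [:: x, y & q] == m.+3.
  by rewrite -(card_vertices_seq uq) -eC C_full cardsT cardG.
have lastE : last x [:: x, y & q] = nth x [:: x, y & q] m.+2.
  by rewrite -nth_last (eqP size_p).
move: adj_q; rewrite /cycle rcons_path => /andP[sorted_q closed_q].
exists (Tuple size_p); rewrite // inE; apply/andP; split; first by apply/and4P.
by rewrite /chord -lastE adj_sym.
Qed.

Lemma mem_hamiltonian_lollipops C :
  hamiltonian_cycle C /\ edge_rel C x y <->
  C \in [set subgraph_of_seq (val p) | p in lollipops 0].
Proof.
split=> [[hamC rC]|/imsetP[p pl ->]].
  by have [p pl ->] := hamiltonian_cycle_lollipop hamC rC; apply: imset_f.
have [q ep /andP[adj_p up]] := lollipops_ucycle pl; split; last first.
  by rewrite edge_rel_seqE // ep mem_head next_head eqxx.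
split; first by exists (val p); split; rewrite ?size_tuple //; apply/andP.
by apply/eqP; rewrite eqEcard subsetT cardsT cardG card_vertices_seq ?size_tuple ?leqnn.
Qed.

Lemma lollipops_inj :
  {in lollipops 0 &, injective (fun p => subgraph_of_seq (val p))}.
Proof.
move=> p p' /lollipops_ucycle[q ep cp] /lollipops_ucycle[q' ep' cp'] e.
apply/val_inj; rewrite /= -!/(val _) ep ep' in cp cp' e *.
by rewrite (subgraph_of_seq_inj _ cp cp' e) // -ep size_tuple.
Qed.

End Lollipops.

Lemma even_hamiltonian_cycles_through (G : sgraph) (s : seq (subgraph G)) (x y : G) :
  (forall z : G, odd #|nbh (@adj G) z|) ->
  uniq s -> (forall C, C \in s <-> hamiltonian_cycle C) ->
  ~~ odd (count (fun C => edge_rel C x y) s).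
Proof.
move=> odd_deg us memE; case es: s => [//|C0 s']; rewrite -es.
have [cycC0 C0_full] : hamiltonian_cycle C0 by apply/memE; rewrite es mem_head.
have [m cardG] : exists m, #|G| = m.+3.
  exists (#|G| - 3); rewrite -addn3 subnK // -cardsT -C0_full.
  by rewrite -supp_edge_rel // -cycle_lengthE // cycle_length_gt2.
rewrite -size_filter -(card_uniqP (filter_uniq _ us)).
rewrite (_ : #|_| = #|[set subgraph_of_seq (val p) | p in lollipops m x y 0]|).
  rewrite card_in_imset; last exact: lollipops_inj.
  exact: even_lollipops0.
apply: eq_card => C; rewrite mem_filter.
have ham_through := mem_hamiltonian_lollipops x y cardG C.
by apply/andP/idP=> [[rC /memE hamC]|/ham_through[/memE]] //; apply/ham_through.
Qed.

Definition unique_hamiltonian_at (G : sgraph) (u : G) (ham : {set G} -> subgraph G) :=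
  forall A : {set G}, A \subset nbh (@adj G) u -> #|A| = 2 ->
  [/\ hamiltonian_cycle (ham A), nbh (edge_rel (ham A)) u = A &
      forall C, hamiltonian_cycle C -> nbh (edge_rel C) u = A -> C = ham A].

Section ThreeHamiltonianCycles.
Variables (G : sgraph) (u : G) (s : seq (subgraph G)).
Hypotheses (cubG : cubic G) (us : uniq s) (size_s : size s = 3).
Hypothesis memE : forall C, C \in s <-> hamiltonian_cycle C.

Lemma card_nbh_hamiltonian C : C \in s -> #|nbh (edge_rel C) u| = 2.
Proof.
move/memE=> [cycC C_full]; rewrite (cycle_rel_deg (is_cycle_edge_rel cycC)) //.
by rewrite supp_edge_rel // C_full inE.
Qed.

Lemma nbh_hamiltonian_sub C : C \in s -> nbh (edge_rel C) u \subset nbh (@adj G) u.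
Proof.
move/memE=> [/is_cycle_edge_rel/cycle_rel_adj sub _].
by apply/subsetP=> w; rewrite !inE => /sub.
Qed.

(* Each of the three counts is odd by Smith's theorem, and they add up to three. *)
Lemma count_hamiltonian_missing d : adj u d -> count (fun C => ~~ edge_rel C u d) s = 1.
Proof.
pose missing w := count (fun C => ~~ edge_rel C u w) s; rewrite -/(missing d) => ud.
have odd_missing w : odd (missing w).
  have := count_predC (fun C => edge_rel C u w) s; rewrite size_s => /(congr1 odd).
  have odd_deg z : odd #|nbh (@adj G) z| by rewrite [#|_|]cubG.
  by rewrite oddD (negPf (even_hamiltonian_cycles_through _ _ odd_deg us memE)).
have total : \sum_(w in nbh (@adj G) u) missing w = 3.
  rewrite /missing; under eq_bigr do rewrite -sum1_count big_mkcond.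
  rewrite exchange_big -size_s -sum1_size; apply: eq_big_seq => C Cs.
  rewrite -big_mkcondr sum1dep_card.
  rewrite (_ : [set _ | _] = nbh (@adj G) u :\: nbh (edge_rel C) u).
    by rewrite cardsDS ?nbh_hamiltonian_sub // card_nbh_hamiltonian // [#|_|]cubG.
  by apply/setP=> w; rewrite !inE andbC.
have rest : 2 <= \sum_(w in nbh (@adj G) u | w != d) missing w.
  have : #|nbh (@adj G) u :\ d| = 2.
    by have := cubG u; rewrite (cardsD1 d) inE ud => -[].
  rewrite -sum1_card => <-; under eq_bigl do rewrite in_setD1 andbC.
  by apply: leq_sum => w _; have := odd_missing w; case: (missing w).
move: total; rewrite (bigD1 d) /= ?inE // => total.
have := odd_missing d; case: (missing d) total => [|n] //; lia.
Qed.

Lemma count_hamiltonian_at (A : {set G}) : A \subset nbh (@adj G) u -> #|A| = 2 ->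
  count (fun C => nbh (edge_rel C) u == A) s = 1.
Proof.
move=> sA cardA; have /cards1P[d ed] : #|nbh (@adj G) u :\: A| == 1.
  by rewrite cardsDS // cardA [#|_|]cubG.
have : d \in nbh (@adj G) u :\: A by rewrite ed set11.
rewrite !inE => /andP[dA ud]; rewrite -(count_hamiltonian_missing ud).
have eA : A = nbh (@adj G) u :\ d by rewrite -ed setDDr setDv set0U (setIidPr sA).
apply: eq_in_count => C Cs; rewrite eqEcard card_nbh_hamiltonian // cardA leqnn andbT.
by rewrite eA subsetD1 nbh_hamiltonian_sub //= inE.
Qed.

End ThreeHamiltonianCycles.

Lemma three_hamiltonian_cycles_unique_at (G : sgraph) (u : G) :
  cubic G -> num_hamiltonian_cycles G 3 -> exists ham, unique_hamiltonian_at u ham.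
Proof.
move=> cubG [s [us size_s memE]]; pose at_u A C := nbh (edge_rel C) u == A.
exists (fun A => head (set0, set0) (filter (at_u A) s)) => A sA cardA.
have := count_hamiltonian_at cubG us size_s memE sA cardA; rewrite -size_filter.
have mem_at C : (C \in filter (at_u A) s) = at_u A C && (C \in s).
  by rewrite mem_filter.
rewrite -/(at_u A); case: (filter _ s) mem_at => [|C [|]] //= mem_at _.
have /andP[/eqP CA /memE hamC] : at_u A C && (C \in s) by rewrite -mem_at mem_head.
split=> // D /memE Ds /eqP DA; have := mem_at D.
by rewrite inE /at_u DA Ds => /eqP.
Qed.

(** * Vertex deletion *)

Lemma adj_neq (G : sgraph) (x y : G) : adj x y -> x != y.
Proof. by apply: contraTneq => ->; rewrite adj_irrefl. Qed.

Section Deletion.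
Variables (G : sgraph) (S : {set G}).

Definition del_val (x : del_vertices S) : G := val (x : {x | x \notin S}).

Lemma del_val_inj : injective del_val.
Proof. exact: val_inj. Qed.

Lemma del_valP x : del_val x \notin S.
Proof. exact: (valP (x : {x | x \notin S})). Qed.

Lemma del_val_surj z : z \notin S -> exists x, del_val x = z.
Proof. by move=> zS; exists (Sub z zS). Qed.

Definition avoid (r : rel G) : rel G := fun x y => [&& r x y, x \notin S & y \notin S].

Lemma avoid_sym r : symmetric r -> symmetric (avoid r).
Proof. by move=> symr x y; rewrite /avoid symr [(x \notin _) && _]andbC. Qed.

Lemma connect_del r x y :
  connect (relpre del_val r) x y = connect (avoid r) (del_val x) (del_val y).
Proof.
apply/idP/idP.
  apply: (connect_homo (f := del_val)) => {}x {}y /= rxy.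
  by apply: connect1; rewrite /avoid rxy !del_valP.
pose lift (z : G) : del_vertices S := insubd (x : {x | x \notin S}) z.
have lift_val z : lift (del_val z) = z by apply: valKd.
rewrite -{2}[x]lift_val -{2}[y]lift_val.
apply: (connect_homo (f := lift)) => a b /and3P[rab aS bS]; apply: connect1.
by rewrite /= /del_val !insubdK.
Qed.

Lemma connected_delP :
  connected (del_vertices S) <->
  {in ~: S &, forall x y, connect (avoid (@adj G)) x y}.
Proof.
split=> [conn x y|conn x y].
  rewrite !in_setC => /del_val_surj[x' <-] /del_val_surj[y' <-].
  by rewrite -connect_del; apply: conn.
by rewrite [connect _ _ _]connect_del conn ?in_setC ?del_valP.
Qed.

End Deletion.

Arguments del_val {G S} x.
Arguments del_val_inj {G S}.

Lemma k_connected_le_degree (G : sgraph) k (x : G) :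
  k_connected k G -> k <= #|nbh (@adj G) x|.
Proof.
case=> kG conn; rewrite leqNgt; apply/negP=> deg_x; set S := nbh (@adj G) x in deg_x.
have xS : x \notin S by rewrite inE adj_irrefl.
have /subsetPn[y _] : ~~ ([set: G] \subset x |: S).
  apply: contraL kG => /subset_leq_card; rewrite cardsT cardsU1 xS -leqNgt.
  by move/leq_trans->.
rewrite in_setU1 negb_or => /andP[yx yS].
have /connected_delP/(_ x y) := conn S deg_x; rewrite !in_setC => /(_ xS yS).
case/connectP=> -[|z p] /=; first by move=> _ ex; rewrite ex eqxx in yx.
by case/andP=> /and3P[xz _]; rewrite inE xz.
Qed.

Lemma cycle_rel_connect_del (G : sgraph) (r : rel G) (u : G)
    (x y : del_vertices [set u]) :
  cycle_rel r -> u \in supp r -> del_val x \in supp r -> del_val y \in supp r ->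
  connect (relpre del_val r) x y.
Proof.
move=> cr ur xr yr; have symr := cycle_rel_sym cr.
have rK := edge_relK symr.
have [c [_ /andP[_ uc] eC]] := is_cycle_subgraph_of_rel cr.
have mem_c z : (z \in supp r) = (z \in c).
  by rewrite -(eq_supp rK) eC supp_edge_rel_seq // inE.
have [i s e] := rot_to (etrans (esym (mem_c u)) ur).
have : cycle r (u :: s) by rewrite -e rot_cycle -(eq_cycle rK) eC cycle_edge_rel_seq.
have : uniq (u :: s) by rewrite -e rot_uniq.
have mem_s z : z \in supp r -> z \notin [set u] -> z \in s.
  by rewrite mem_c -(mem_rot i) e !inE => /orP[->|].
rewrite /= rcons_path => /andP[us _] /andP[+ _].
rewrite connect_del; have := mem_s _ yr (del_valP y); have := mem_s _ xr (del_valP x).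
case: s us {e mem_s} => // a s us xs ys /= /andP[_ path_s].
suff conn_a z : z \in a :: s -> connect (avoid [set u] r) a z.
  rewrite (connect_trans _ (conn_a _ ys)) // sym_connect_sym ?conn_a //.
  exact: avoid_sym.
apply: path_connect; apply: (sub_in_path (P := predC1 u)) path_s.
  by move=> b b'; rewrite /avoid !inE => -> -> ->.
by apply/allP=> b bs; apply: contraNneq us => <-.
Qed.

Lemma del_val_neq (G : sgraph) (u : G) (x : del_vertices [set u]) : del_val x != u.
Proof. by have := del_valP x; rewrite inE. Qed.

Lemma del1_val_surj (G : sgraph) (u z : G) :
  z != u -> exists x : del_vertices [set u], del_val x = z.
Proof. by move=> zu; apply: del_val_surj; rewrite inE. Qed.

Section Quotient.
Variables (T U : finType) (f : T -> U) (r : rel T).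

Definition quo_rel : rel U := fun a b =>
  (a != b) && [exists p, exists q, [&& r p q, f p == a & f q == b]].

Lemma quo_relP a b :
  reflect (a != b /\ exists p q, [/\ r p q, f p = a & f q = b]) (quo_rel a b).
Proof.
apply: (iffP andP) => -[nab]; last first.
  case=> p [q [rpq fp fq]]; split=> //; apply/existsP; exists p.
  by apply/existsP; exists q; rewrite rpq fp fq !eqxx.
case/existsP=> p /existsP[q /and3P[rpq /eqP fp /eqP fq]].
by split=> //; exists p, q.
Qed.

Lemma quo_rel_sym : symmetric r -> symmetric quo_rel.
Proof.
move=> symr a b; apply/quo_relP/quo_relP=> -[nab [p [q [rpq fp fq]]]];
by rewrite eq_sym; split=> //; exists q, p; rewrite symr.
Qed.

Lemma quo_rel_irr : irreflexive quo_rel.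
Proof. by move=> a; rewrite /quo_rel eqxx. Qed.

Lemma quo_rel_connect : {in supp r &, forall x y, connect r x y} ->
  {in supp quo_rel &, forall a b, connect quo_rel a b}.
Proof.
move=> conn a b /suppP[a' /quo_relP[_ [p [p' [rp <- _]]]]].
move=> /suppP[b' /quo_relP[_ [q [q' [rq <- _]]]]].
apply: connect_homo (conn p q (mem_supp rp) (mem_supp rq)) => x y rxy.
have [->|nxy] := eqVneq (f x) (f y); first exact: connect0.
by apply/connect1/quo_relP; split=> //; exists x, y.
Qed.

End Quotient.

(** * Substituting [G2 - u] for the vertices of a graph *)

Section Substitution.
Variables (G2 : sgraph) (u : G2).
Local Notation H := (del_vertices [set u]).
Variables (x0 : H) (G : sgraph).

Definition terminals : seq H := enum [set x : H | adj u (del_val x)].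

(* The default value [x0] is irrelevant when [v] has the same degree as [u]. *)
Definition port (v w : G) : H := nth x0 terminals (index w (enum (nbh (@adj G) v))).

Definition subst_adj : rel (G * H) := fun p q =>
  (p.1 == q.1) && adj p.2 q.2 ||
  [&& adj p.1 q.1, p.2 == port p.1 q.1 & q.2 == port q.1 p.1].

Lemma subst_adj_sym : symmetric subst_adj.
Proof.
move=> p q; rewrite /subst_adj eq_sym adj_sym [adj p.1 _]adj_sym.
by rewrite [(p.2 == _) && _]andbC.
Qed.

Lemma subst_adj_irrefl : irreflexive subst_adj.
Proof. by move=> p; rewrite /subst_adj !adj_irrefl andbF. Qed.

Definition subst_graph : sgraph := SGraph subst_adj_sym subst_adj_irrefl.

Local Notation F := subst_graph.
Local Notation pt v x := ((v, x) : F).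

Definition contract (v : G) (p : F) : G2 := if p.1 == v then del_val p.2 else u.

Definition base_rel (r : rel F) : rel G := quo_rel (fun p : F => p.1) r.

Definition trace_rel (v : G) (r : rel F) : rel G2 := quo_rel (contract v) r.

Definition fiber (r : rel F) (v : G) : {set H} := [set x | pt v x \in supp r].

Definition ends (rs : rel G) (v : G) : {set G2} := (del_val \o port v) @: nbh rs v.

Lemma card_subst : #|F| = #|G| * #|H|.
Proof. exact: card_prod. Qed.

Lemma size_terminals : size terminals = #|nbh (@adj G2) u|.
Proof.
rewrite -cardE -(card_imset _ del_val_inj); apply: eq_card => z.
rewrite [RHS]inE; apply/imsetP/idP=> [[x xt ->]|uz]; first by rewrite inE in xt.
have [x ex] : exists x : H, del_val x = z.
  by apply: del1_val_surj; apply: contraTneq uz => ->; rewrite adj_irrefl.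
by exists x; rewrite // inE ex.
Qed.

Lemma degree_le_card_del : #|nbh (@adj G2) u| <= #|H|.
Proof. by rewrite -size_terminals -(card_uniqP (enum_uniq _)) max_card. Qed.

Lemma subst_adj_in v x y : adj (pt v x) (pt v y) = adj x y.
Proof. by rewrite /= /subst_adj /= eqxx adj_irrefl /= orbF. Qed.

Lemma subst_adj_out v w x y : v != w ->
  adj (pt v x) (pt w y) = [&& adj v w, x == port v w & y == port w v].
Proof. by rewrite /= /subst_adj /= => /negPf->. Qed.

Lemma subst_adj_port v w : adj v w -> adj (pt v (port v w)) (pt w (port w v)).
Proof. by move=> vw; rewrite subst_adj_out ?adj_neq // vw !eqxx. Qed.

Lemma contract_in v x : contract v (pt v x) = del_val x.
Proof. by rewrite /contract eqxx. Qed.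

Lemma contract_out v w x : w != v -> contract v (pt w x) = u.
Proof. by rewrite /contract /= => /negPf->. Qed.

Lemma contract_eq_val v p x : contract v p = del_val x -> p = pt v x.
Proof.
case: p => w y; rewrite /contract /=; case: eqP => [-> /del_val_inj-> //|_ ux].
by have := del_val_neq x; rewrite -ux eqxx.
Qed.

Section Ports.
Hypothesis deg_eq : forall v : G, #|nbh (@adj G) v| = #|nbh (@adj G2) u|.

Lemma index_nbh_terminals v w :
  (index w (enum (nbh (@adj G) v)) < size terminals) = adj v w.
Proof. by rewrite size_terminals -(deg_eq v) cardE index_mem mem_enum inE. Qed.

Lemma port_adj v w : adj v w -> adj u (del_val (port v w)).
Proof.
move=> vw; have : port v w \in terminals; last by rewrite mem_enum inE.
by rewrite mem_nth // index_nbh_terminals.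
Qed.

Lemma port_inj v : {in nbh (@adj G) v &, injective (port v)}.
Proof.
move=> w w'; rewrite !inE => vw vw' /eqP.
rewrite nth_uniq ?index_nbh_terminals ?enum_uniq // => /eqP.
by apply: (index_inj v); rewrite mem_enum inE.
Qed.

Lemma port_surj v x : adj u (del_val x) -> exists2 w, adj v w & port v w = x.
Proof.
move=> ux; have xt : x \in terminals by rewrite mem_enum inE.
have it : index x terminals < size (enum (nbh (@adj G) v)).
  by rewrite -cardE deg_eq -size_terminals index_mem.
exists (nth v (enum (nbh (@adj G) v)) (index x terminals)).
  by have := mem_nth v it; rewrite mem_enum inE.
by rewrite /port index_uniq ?enum_uniq // nth_index.
Qed.

Lemma contract_inj v x : {in nbh (@adj F) (pt v x) &, injective (contract v)}.
Proof.
move=> [w y] [w' y']; rewrite !in_set; have [<-|nw] := eqVneq v w.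
  by rewrite contract_in => _ _ /esym/contract_eq_val->.
have [<-|nw'] := eqVneq v w'.
  by rewrite contract_in => _ _ /contract_eq_val->.
rewrite !subst_adj_out // => /and3P[vw /eqP-> /eqP->] /and3P[vw' /eqP ep /eqP->] _.
by rewrite (port_inj _ _ ep) ?inE.
Qed.

Lemma contract_adj v x p : adj (pt v x) p -> adj (del_val x) (contract v p).
Proof.
case: p => w y; have [<-|nw] := eqVneq v w; first by rewrite subst_adj_in contract_in.
rewrite subst_adj_out // contract_out; last by rewrite eq_sym.
by case/and3P=> vw /eqP-> _; rewrite adj_sym port_adj.
Qed.

Lemma contract_nbh v x :
  contract v @: nbh (@adj F) (pt v x) = nbh (@adj G2) (del_val x).
Proof.
apply/setP=> z; rewrite [RHS]inE; apply/imsetP/idP=> [[p]|].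
  by rewrite inE => xp ->; apply: contract_adj.
have [->|/del1_val_surj[y <-] xy] := eqVneq z u; last first.
  by exists (pt v y); rewrite ?contract_in // in_set subst_adj_in.
rewrite adj_sym => /(port_surj v)[w vw <-]; exists (pt w (port w v)).
  by rewrite in_set subst_adj_port.
by rewrite contract_out // eq_sym adj_neq.
Qed.

Lemma card_nbh_subst v x : #|nbh (@adj F) (pt v x)| = #|nbh (@adj G2) (del_val x)|.
Proof. by rewrite -(contract_nbh v) card_in_imset //; apply: contract_inj. Qed.

Lemma cubic_subst : cubic G2 -> cubic F.
Proof. by move=> cubG2 [v x]; rewrite [LHS]card_nbh_subst [LHS]cubG2. Qed.

Lemma ends_sub (rs : rel G) v : subrel rs (@adj G) -> ends rs v \subset nbh (@adj G2) u.
Proof.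
move=> rs_adj; apply/subsetP=> z /imsetP[w]; rewrite inE => /rs_adj vw ->.
by rewrite inE; apply: port_adj.
Qed.

Lemma card_ends (rs : rel G) v : subrel rs (@adj G) -> #|ends rs v| = #|nbh rs v|.
Proof.
move=> rs_adj; rewrite card_in_imset // => w w'; rewrite !inE => /rs_adj vw /rs_adj vw'.
by move/del_val_inj/port_inj; apply; rewrite inE.
Qed.

Section SymmetricSubrel.
Variable r : rel F.
Hypotheses (symr : symmetric r) (adjr : subrel r (@adj F)).

Lemma base_relE v w : base_rel r v w = adj v w && r (pt v (port v w)) (pt w (port w v)).
Proof.
apply/quo_relP/andP=> [[nvw [[a x] [[b y] [rpq /= av bw]]]]|[vw rvw]].
  subst a b; have := adjr rpq; rewrite subst_adj_out // => /and3P[vw /eqP ex /eqP ey].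
  by rewrite vw -ex -ey.
by split; [apply: adj_neq | exists (pt v (port v w)), (pt w (port w v))].
Qed.

Lemma base_rel_adj : subrel (base_rel r) (@adj G).
Proof. by move=> v w; rewrite base_relE => /andP[]. Qed.

Lemma rel_out v w x y : v != w ->
  r (pt v x) (pt w y) -> [/\ base_rel r v w, x = port v w & y = port w v].
Proof.
move=> nvw rxy; have := adjr rxy; rewrite subst_adj_out //.
by case/and3P=> vw /eqP ex /eqP ey; rewrite base_relE vw -ex -ey.
Qed.

Lemma trace_rel_in v x y : trace_rel v r (del_val x) (del_val y) = r (pt v x) (pt v y).
Proof.
apply/quo_relP/idP=> [[_ [p [q [rpq /contract_eq_val <- /contract_eq_val <-]]]] //|rxy].
split; last by exists (pt v x), (pt v y); rewrite !contract_in.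
by rewrite (inj_eq del_val_inj) adj_neq // -(subst_adj_in v) adjr.
Qed.

Lemma nbh_trace_val v x :
  nbh (trace_rel v r) (del_val x) = contract v @: nbh r (pt v x).
Proof.
apply/setP=> z; rewrite inE; apply/quo_relP/imsetP.
  by case=> _ [p [q [rpq /contract_eq_val ep <-]]]; exists q; rewrite // inE -ep.
case=> q; rewrite inE => rq ->; split; last by exists (pt v x), q; rewrite contract_in.
by rewrite adj_neq // contract_adj // adjr.
Qed.

Lemma card_nbh_trace_val v x : #|nbh (trace_rel v r) (del_val x)| = #|nbh r (pt v x)|.
Proof.
rewrite nbh_trace_val card_in_imset // => p q; rewrite !inE => /adjr xp /adjr xq.
by apply: (contract_inj (x := x)); rewrite inE.
Qed.

Lemma nbh_trace_u v : nbh (trace_rel v r) u = ends (base_rel r) v.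
Proof.
apply/setP=> z; rewrite inE; apply/quo_relP/imsetP.
  case=> nuz [[w x] [[w' y] [rpq ep eq_z]]].
  have nw : w != v.
    apply/eqP=> ew; subst w.
    by have := del_val_neq x; rewrite -(contract_in v) ep eqxx.
  have ew' : w' = v by apply: contraNeq nuz => nw'; rewrite -eq_z contract_out.
  subst w'; have [wv _ ey] := rel_out nw rpq.
  exists w; last by rewrite -eq_z contract_in ey.
  by rewrite inE /base_rel quo_rel_sym.
case=> w; rewrite inE base_relE => /andP[vw rvw] ->; split.
  by rewrite eq_sym del_val_neq.
exists (pt w (port w v)), (pt v (port v w)).
by rewrite symr rvw contract_in contract_out // eq_sym adj_neq.
Qed.

Lemma supp_trace_val v x : (del_val x \in supp (trace_rel v r)) = (x \in fiber r v).
Proof. by rewrite [RHS]in_set !supp_nbh card_nbh_trace_val. Qed.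

Lemma supp_trace_u v : (u \in supp (trace_rel v r)) = (v \in supp (base_rel r)).
Proof. by rewrite !supp_nbh nbh_trace_u card_ends //; apply: base_rel_adj. Qed.

(* The degrees of the trace add up to an even number, and only [u] can
   contribute an odd one. *)
Lemma even_nbh_base v :
  (forall x, ~~ odd #|nbh r (pt v x)|) -> ~~ odd #|nbh (base_rel r) v|.
Proof.
move=> even_r.
have := handshake (quo_rel_sym (contract v) symr) (quo_rel_irr _ _).
rewrite (bigD1 u) //= oddD -/(trace_rel v r) nbh_trace_u.
rewrite card_ends; last exact: base_rel_adj.
suff /negPf-> : ~~ odd (\sum_(z | z != u) #|nbh (trace_rel v r) z|) by rewrite addbF.
rewrite -dvdn2; apply: dvdn_sum => z /del1_val_surj[x <-].
by rewrite dvdn2 card_nbh_trace_val.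
Qed.

End SymmetricSubrel.

Section CycleRelSubst.
Hypothesis cubG : cubic G.
Variable r : rel F.
Hypothesis cr : cycle_rel r.

Let symr : symmetric r. Proof. exact: cycle_rel_sym cr. Qed.
Let adjr : subrel r (@adj F). Proof. exact: cycle_rel_adj cr. Qed.

Lemma card_nbh_base v : v \in supp (base_rel r) -> #|nbh (base_rel r) v| = 2.
Proof.
have : ~~ odd #|nbh (base_rel r) v|.
  apply: even_nbh_base => // x; case: (posnP #|nbh r (pt v x)|) => [->//|].
  by rewrite -supp_nbh => /(cycle_rel_deg cr)->.
have : #|nbh (base_rel r) v| <= 3.
  rewrite -(cubG v); apply/subset_leq_card/subsetP=> w.
  by rewrite !inE; apply: base_rel_adj.
by rewrite supp_nbh; case: #|_| => [|[|[|[|]]]].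
Qed.

Lemma cycle_rel_base : supp (base_rel r) != set0 -> cycle_rel (base_rel r).
Proof.
split=> //; first exact: quo_rel_sym.
- exact: base_rel_adj.
- exact: card_nbh_base.
- exact/quo_rel_connect/cycle_rel_connect.
Qed.

Lemma cycle_rel_trace v x : x \in fiber r v -> cycle_rel (trace_rel v r).
Proof.
move=> xr; split; first exact: quo_rel_sym.
- move=> a b rab; have : b \in nbh (trace_rel v r) a by rewrite inE.
  have [->|/del1_val_surj[y <-]] := eqVneq a u.
    rewrite nbh_trace_u // => /(subsetP (ends_sub v (base_rel_adj adjr))).
    by rewrite inE.
  rewrite nbh_trace_val // => /imsetP[p]; rewrite inE => /adjr yp ->.
  exact: contract_adj.
- move=> a; have [->|/del1_val_surj[y <-]] := eqVneq a u.
    rewrite supp_trace_u // nbh_trace_u // card_ends; first exact: card_nbh_base.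
    exact: base_rel_adj.
  by rewrite supp_trace_val // card_nbh_trace_val // inE; apply: cycle_rel_deg.
- by apply/set0Pn; exists (del_val x); rewrite supp_trace_val.
- exact/quo_rel_connect/cycle_rel_connect.
Qed.

Lemma card_supp_trace v :
  #|supp (trace_rel v r)| = (v \in supp (base_rel r)) + #|fiber r v|.
Proof.
rewrite (cardsD1 u) supp_trace_u // -(card_imset _ del_val_inj); congr (_ + _).
apply: eq_card => z; rewrite in_setD1; apply/andP/imsetP=> [[/del1_val_surj[x <-]]|[x]].
  by rewrite supp_trace_val //; exists x.
by move=> xr ->; rewrite supp_trace_val // del_val_neq.
Qed.

Lemma card_supp_fibers : #|supp r| = \sum_(v : G) #|fiber r v|.
Proof.
under eq_bigr do rewrite -sum1dep_card.
by rewrite -sum1_card pair_big_dep; apply: eq_bigl => -[v x].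
Qed.

Lemma supp_sub_copy v x p :
  v \notin supp (base_rel r) -> x \in fiber r v -> p \in supp r -> p.1 = v.
Proof.
move=> vr; rewrite in_set => xr pr.
have closed_v : closed r [pred q : F | q.1 == v].
  move=> a b rab; rewrite !inE; have [->//|nab] := eqVneq a.1 b.1.
  have base_ab : base_rel r a.1 b.1 by apply/quo_relP; split=> //; exists a, b.
  have base_ba : base_rel r b.1 a.1 by rewrite /base_rel quo_rel_sym.
  have neq_v w w' : base_rel r w w' -> (w == v) = false.
    by move=> ww'; apply: contraNF vr => /eqP<-; apply: mem_supp ww'.
  by rewrite (neq_v _ _ base_ab) (neq_v _ _ base_ba).
have := closed_connect closed_v (cycle_rel_connect cr xr pr).
by rewrite !inE eqxx => /esym/eqP.
Qed.

Lemma fiber_base v x :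
  supp (base_rel r) != set0 -> x \in fiber r v -> v \in supp (base_rel r).
Proof.
case/set0Pn=> w wr xr; apply: contraT => vr.
have /suppP[w'] := wr; rewrite base_relE // => /andP[_ /mem_supp wr'].
by have /= wv := supp_sub_copy vr xr wr'; rewrite -wv wr in vr.
Qed.

Lemma card_supp_base : supp (base_rel r) != set0 ->
  #|supp r| = \sum_(v in supp (base_rel r)) #|fiber r v|.
Proof.
move=> base0; rewrite card_supp_fibers [RHS]big_mkcond; apply: eq_bigr => v _.
case: ifPn => // vr; apply/eqP; rewrite cards_eq0; apply/set0Pn=> -[x xr].
by rewrite (fiber_base base0 xr) in vr.
Qed.

Lemma card_supp_copy : supp (base_rel r) = set0 ->
  exists v x, x \in fiber r v /\ #|supp r| = #|fiber r v|.
Proof.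
move=> base0; have /set0Pn[[v x] vxr] := cycle_rel_neq0 cr.
have vr : v \notin supp (base_rel r) by rewrite base0 inE.
have xr : x \in fiber r v by rewrite inE.
exists v, x; split=> //; rewrite card_supp_fibers (bigD1 v) //= big1 ?addn0 //.
move=> w nwv; apply/eqP; rewrite cards_eq0; apply/set0Pn=> -[y]; rewrite inE.
by move/(supp_sub_copy vr xr)=> /= wv; rewrite wv eqxx in nwv.
Qed.

Lemma card_supp_le : #|supp r| <= maxn 1 #|supp (base_rel r)| * #|H|.
Proof.
have [base0|base0] := eqVneq (supp (base_rel r)) set0.
  by have [v [x [_ ->]]] := card_supp_copy base0; rewrite base0 cards0 mul1n max_card.
rewrite card_supp_base // (maxn_idPr _) ?card_gt0 // -sum_nat_const.
by apply: leq_sum => v _; apply: max_card.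
Qed.

Lemma full_fibers : supp (base_rel r) != set0 ->
  #|supp (base_rel r)| * #|H| <= #|supp r| ->
  {in supp (base_rel r), forall v, fiber r v = [set: H]}.
Proof.
move=> base0; rewrite card_supp_base // => full v vr.
apply/eqP; rewrite eqEcard subsetT cardsT /=.
have : \sum_(w in supp (base_rel r)) (#|H| - #|fiber r w|) == 0.
  by rewrite sumnB => [|w _]; rewrite ?max_card // sum_nat_const subn_eq0.
by rewrite sum_nat_eq0 => /forallP/(_ v)/implyP/(_ vr); rewrite subn_eq0.
Qed.

Lemma girth_cycle_rel_subst g g2 :
  girth_ge G g -> girth_ge G2 g2 -> minn (2 * g) g2 <= #|supp r|.
Proof.
move=> /girth_geP girth1 /girth_geP girth2; rewrite geq_min; apply/orP.
have [base0|base0] := eqVneq (supp (base_rel r)) set0.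
  right; have [v [x [/cycle_rel_trace/girth2 + ->]]] := card_supp_copy base0.
  by rewrite card_supp_trace base0 inE.
left; rewrite card_supp_base //.
apply: leq_trans (leq_mul (leqnn 2) (girth1 _ (cycle_rel_base base0))) _.
rewrite mulnC -sum_nat_const; apply: leq_sum => v vr; have /suppP[w] := vr.
rewrite base_relE // => /andP[_ /mem_supp port_r].
have xr : port v w \in fiber r v by rewrite inE.
by have := cycle_rel_gt2 (cycle_rel_trace xr); rewrite card_supp_trace vr.
Qed.

End CycleRelSubst.

Lemma girth_ge_subst g g2 : cubic G ->
  girth_ge G g -> girth_ge G2 g2 -> girth_ge F (minn (2 * g) g2).
Proof.
by move=> cubG girth1 girth2; apply/girth_geP => r cr; apply: girth_cycle_rel_subst.
Qed.

Section Expansion.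
Variable ham : {set G2} -> subgraph G2.
Hypothesis hamP : unique_hamiltonian_at u ham.

Definition copy_rel (rs : rel G) (v : G) : rel G2 := edge_rel (ham (ends rs v)).

Definition expand (rs : rel G) : rel F := fun p q =>
  if p.1 == q.1 then (p.1 \in supp rs) && copy_rel rs p.1 (del_val p.2) (del_val q.2)
  else [&& rs p.1 q.1, p.2 == port p.1 q.1 & q.2 == port q.1 p.1].

Lemma eq_copy_rel (r1 r2 : rel G) v : r1 =2 r2 -> copy_rel r1 v = copy_rel r2 v.
Proof. by move=> e; rewrite /copy_rel /ends (eq_nbh e). Qed.

Lemma eq_expand (r1 r2 : rel G) : r1 =2 r2 -> expand r1 =2 expand r2.
Proof. by move=> e p q; rewrite /expand (eq_supp e) (eq_copy_rel _ e) e. Qed.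

Section ExpandCycle.
Variable rs : rel G.
Hypothesis crs : cycle_rel rs.

Let symrs : symmetric rs. Proof. exact: cycle_rel_sym crs. Qed.
Let adjrs : subrel rs (@adj G). Proof. exact: cycle_rel_adj crs. Qed.

Lemma copy_relP v : v \in supp rs ->
  [/\ cycle_rel (copy_rel rs v), forall z, z \in supp (copy_rel rs v) &
      nbh (copy_rel rs v) u = ends rs v].
Proof.
move=> vs; have ends2 : #|ends rs v| = 2 by rewrite card_ends // (cycle_rel_deg crs).
have [[cyc_ham ham_full] ham_u _] := hamP (ends_sub v adjrs) ends2.
by split=> // [|z]; [apply: is_cycle_edge_rel | rewrite supp_edge_rel // ham_full inE].
Qed.

Lemma expand_in v x y : v \in supp rs ->
  expand rs (pt v x) (pt v y) = copy_rel rs v (del_val x) (del_val y).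
Proof. by move=> vs; rewrite /expand eqxx vs. Qed.

Lemma expand_out v w x y : v != w ->
  expand rs (pt v x) (pt w y) = [&& rs v w, x == port v w & y == port w v].
Proof. by rewrite /expand /= => /negPf->. Qed.

Lemma expand_port v w : rs v w -> expand rs (pt v (port v w)) (pt w (port w v)).
Proof. by move=> rvw; rewrite expand_out ?rvw ?eqxx // adj_neq // adjrs. Qed.

Lemma expand_sym : symmetric (expand rs).
Proof.
move=> [v x] [w y]; rewrite /expand /= eq_sym; case: eqP => [->|_].
  by rewrite /copy_rel edge_rel_sym.
by rewrite symrs [(x == _) && _]andbC.
Qed.

Lemma expand_adj : subrel (expand rs) (@adj F).
Proof.
move=> [v x] [w y]; have [<-|nvw] := eqVneq v w.
  rewrite subst_adj_in /expand eqxx => /andP[/copy_relP[cv _ _]].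
  exact: cycle_rel_adj cv _ _.
by rewrite expand_out // subst_adj_out // => /and3P[/adjrs-> -> ->].
Qed.

Lemma contract_nbh_expand v x : v \in supp rs ->
  contract v @: nbh (expand rs) (pt v x) = nbh (copy_rel rs v) (del_val x).
Proof.
move=> vs; have [cv _ nbh_u] := copy_relP vs.
have copy_u z : copy_rel rs v z u = (z \in ends rs v).
  by rewrite (cycle_rel_sym cv) -nbh_u inE.
apply/setP=> z; rewrite [RHS]inE; apply/imsetP/idP=> [[[w y]]|].
  rewrite inE; have [<-|nvw] := eqVneq v w.
    by rewrite expand_in // contract_in => + ->.
  rewrite expand_out // contract_out; last by rewrite eq_sym.
  by case/and3P=> rvw /eqP-> _ ->; rewrite copy_u; apply/imsetP; exists w; rewrite ?inE.
have [->|/del1_val_surj[y <-]] := eqVneq z u; last first.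
  by exists (pt v y); rewrite ?inE ?expand_in ?contract_in.
rewrite copy_u => /imsetP[w]; rewrite inE => rvw /del_val_inj ->.
exists (pt w (port w v)); first by rewrite inE expand_port.
by rewrite contract_out // eq_sym adj_neq // adjrs.
Qed.

Lemma card_nbh_expand v x : v \in supp rs -> #|nbh (expand rs) (pt v x)| = 2.
Proof.
move=> vs; have [cv supp_v _] := copy_relP vs.
rewrite -(cycle_rel_deg cv (supp_v (del_val x))) -contract_nbh_expand //.
rewrite card_in_imset //.
move=> p q; rewrite !inE => /expand_adj xp /expand_adj xq.
by apply: (contract_inj (x := x)); rewrite inE.
Qed.

Lemma supp_expand v x : (pt v x \in supp (expand rs)) = (v \in supp rs).
Proof.
apply/idP/idP=> [/suppP[[w y]]|vs]; last by rewrite supp_nbh card_nbh_expand.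
have [<-|nvw] := eqVneq v w; first by rewrite /expand eqxx => /andP[].
by rewrite expand_out // => /andP[/mem_supp].
Qed.

Lemma card_supp_expand : #|supp (expand rs)| = #|supp rs| * #|H|.
Proof.
rewrite -[#|H|]cardsT -cardsX; apply: eq_card => -[v x].
by rewrite supp_expand in_setX in_setT andbT.
Qed.

Lemma expand_connect : {in supp (expand rs) &, forall p q, connect (expand rs) p q}.
Proof.
have copy v x y : v \in supp rs -> connect (expand rs) (pt v x) (pt v y).
  move=> vs; have [cv supp_v _] := copy_relP vs.
  apply: (connect_homo (f := fun z : H => pt v z)); last first.
    exact: (cycle_rel_connect_del cv (supp_v u) (supp_v _) (supp_v _)).
  by move=> a b rab; apply: connect1; rewrite expand_in.
move=> [v x] [w y]; rewrite !supp_expand => vs ws.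
apply: connect_trans (copy w x y ws).
apply: (connect_homo (f := fun a => pt a x)) (cycle_rel_connect crs vs ws) => a b rab.
have [a_rs b_rs] : a \in supp rs /\ b \in supp rs.
  by split; [apply: mem_supp rab | apply: (@mem_supp _ _ _ a); rewrite symrs].
apply: connect_trans (copy a x (port a b) a_rs) _.
exact: connect_trans (connect1 (expand_port rab)) (copy b _ x b_rs).
Qed.

Lemma cycle_rel_expand : cycle_rel (expand rs).
Proof.
split; first exact: expand_sym.
- exact: expand_adj.
- by case=> v x; rewrite supp_expand; apply: card_nbh_expand.
- have /set0Pn[v vs] := cycle_rel_neq0 crs.
  by apply/set0Pn; exists (pt v x0); rewrite supp_expand.
- exact: expand_connect.
Qed.

End ExpandCycle.

Lemma full_trace_copy (r : rel F) v :
  cubic G -> cycle_rel r -> v \in supp (base_rel r) -> fiber r v = [set: H] ->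
  trace_rel v r =2 copy_rel (base_rel r) v.
Proof.
move=> cubG cr vb full; have symr := cycle_rel_sym cr; have adjr := cycle_rel_adj cr.
have /set0Pn[x xr] : fiber r v != set0 by rewrite full; apply/set0Pn; exists x0.
have ct := cycle_rel_trace cubG cr xr; have traceK := edge_relK (cycle_rel_sym ct).
have ends2 : #|ends (base_rel r) v| = 2.
  by rewrite card_ends ?(card_nbh_base cubG cr) //; apply: base_rel_adj.
have [_ _ uniq_ham] := hamP (ends_sub v (base_rel_adj adjr)) ends2.
move=> a b; rewrite /copy_rel -(uniq_ham (subgraph_of_rel (trace_rel v r))) ?traceK //.
  split; first exact: is_cycle_subgraph_of_rel.
  apply/setP=> z; rewrite in_setT; have [->|/del1_val_surj[y <-]] := eqVneq z u.
    by rewrite /= supp_trace_u.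
  by rewrite /= supp_trace_val // full in_setT.
by rewrite (eq_nbh traceK) nbh_trace_u.
Qed.

Lemma full_fibers_expand (r : rel F) :
  cubic G -> cycle_rel r -> supp (base_rel r) != set0 ->
  {in supp (base_rel r), forall v, fiber r v = [set: H]} -> r =2 expand (base_rel r).
Proof.
move=> cubG cr base0 full; have cb := cycle_rel_base cubG cr base0.
have adjr := cycle_rel_adj cr.
apply: (cycle_rel_sub_eq (cycle_rel_expand cb) cr) => -[v x] [w y] rxy.
have [ew|nvw] := eqVneq v w; last first.
  have [rvw -> ->] := rel_out adjr nvw rxy; exact: expand_port.
subst w; have xr : x \in fiber r v by rewrite in_set (mem_supp rxy).
have vb := fiber_base cr base0 xr.
by rewrite expand_in // -full_trace_copy ?full // trace_rel_in.
Qed.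

Lemma unique_longest_subst :
  cubic G -> unique_longest_cycle G -> unique_longest_cycle F.
Proof.
move=> cubG /unique_longest_cycleP[rs crs uniq_rs].
have H_gt0 : 0 < #|H| by apply/card_gt0P; exists x0.
apply/unique_longest_cycleP; exists (expand rs) => [|r cr].
  exact: cycle_rel_expand.
rewrite card_supp_expand // => le_r.
have le_base : #|supp rs| <= maxn 1 #|supp (base_rel r)|.
  by rewrite -(leq_pmul2r H_gt0) (leq_trans le_r) // card_supp_le.
have base_gt1 : 1 < #|supp (base_rel r)|.
  by have := leq_trans (cycle_rel_gt2 crs) le_base; case: #|_| => [|[]].
have base0 : supp (base_rel r) != set0 by rewrite -card_gt0 ltnW.
have base_rs : base_rel r =2 rs.
  apply: uniq_rs (cycle_rel_base cubG cr base0) _.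
  by rewrite (maxn_idPr (ltnW base_gt1)) in le_base.
move=> p q; rewrite -(eq_expand base_rs); apply: full_fibers_expand => //.
by apply: full_fibers; rewrite // (eq_supp base_rs).
Qed.

End Expansion.

Section Connectivity.
Variables (k k2 : nat) (S : {set F}).
Hypotheses (connG : k_connected k G) (connH : k_connected k2 H).
Hypotheses (Sk : #|S| < k) (Sk2 : #|S| < k2).

Lemma connect_copy v x y : pt v x \notin S -> pt v y \notin S ->
  connect (avoid S (@adj F)) (pt v x) (pt v y).
Proof.
move=> xS yS; pose Sv := [set z | pt v z \in S].
have Sv_k2 : #|Sv| < k2.
  apply: leq_ltn_trans Sk2; rewrite -(card_imset (mem Sv) (f := pair v)).
    by apply/subset_leq_card/subsetP=> p /imsetP[z]; rewrite inE => zS ->.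
  by move=> a b [].
have /connected_delP conn := connH.2 Sv Sv_k2.
apply: (connect_homo (f := fun z => pt v z)) (conn x y _ _); rewrite ?inE //.
move=> a b /and3P[ab]; rewrite !inE => aS bS.
by apply: connect1; rewrite /avoid subst_adj_in ab aS.
Qed.

Lemma connect_ports v w :
  adj v w -> pt v (port v w) \notin S -> pt w (port w v) \notin S ->
  connect (avoid S (@adj F)) (pt v (port v w)) (pt w (port w v)).
Proof. by move=> vw vS wS; apply: connect1; rewrite /avoid subst_adj_port // vS. Qed.

Let touched := [set p.1 | p : F in S].

Let untouched v x : v \notin touched -> pt v x \notin S.
Proof. by apply: contra => xS; apply/imsetP; exists (pt v x). Qed.

(* Each element of [S] blocks at most one of the more than [#|S|] exits of a copy. *)
Lemma open_port v :
  exists2 w, adj v w & (pt v (port v w) \notin S) && (w \notin touched).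
Proof.
pose copy := [set p : F | p.1 == v].
pose blocked := [set w in nbh (@adj G) v | pt v (port v w) \in S].
pose outside := [set p.1 | p : F in S :\: copy].
have le_blocked : #|blocked| <= #|S :&: copy|.
  rewrite -(card_in_imset (f := fun w => pt v (port v w))).
    apply/subset_leq_card/subsetP=> p /imsetP[w]; rewrite !inE => /andP[_ portS] ->.
    by rewrite portS /=.
  move=> w w'; rewrite !inE => /andP[vw _] /andP[vw' _] [] /port_inj.
  by apply; rewrite inE.
have le_outside : #|outside| <= #|S :\: copy| by apply: leq_imset_card.
have /subsetPn[w] : ~~ (nbh (@adj G) v \subset blocked :|: outside).
  apply: contraL (leq_trans Sk (k_connected_le_degree v connG)).
  move/subset_leq_card=> le_nbh; rewrite -leqNgt (leq_trans le_nbh) //.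
  by rewrite (leq_trans (leq_card_setU _ _)) // -(cardsID copy S) leq_add.
rewrite inE => vw; rewrite in_setU inE inE vw negb_or /= => /andP[portS w_out].
exists w; rewrite // portS; apply: contra w_out => /imsetP[p pS ew].
by apply/imsetP; exists p; rewrite // !inE pS -ew eq_sym adj_neq.
Qed.

Lemma connect_to_untouched v x : pt v x \notin S ->
  exists2 w, w \notin touched & connect (avoid S (@adj F)) (pt v x) (pt w x0).
Proof.
move=> xS; have [w vw /andP[portS wS]] := open_port v; exists w => //.
apply: connect_trans (connect_copy xS portS) _.
by apply: connect_trans (connect_ports vw portS _) (connect_copy _ _); apply: untouched.
Qed.

Lemma connect_untouched v w : v \notin touched -> w \notin touched ->
  connect (avoid S (@adj F)) (pt v x0) (pt w x0).
Proof.
move=> vS wS.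
have touched_k : #|touched| < k by apply: leq_ltn_trans (leq_imset_card _ _) Sk.
have /connected_delP conn := connG.2 touched touched_k.
apply: (connect_homo (f := fun a => pt a x0)) (conn v w _ _); rewrite ?in_setC //.
move=> a b /and3P[ab aS bS].
apply: (connect_trans (connect_copy _ _)); [exact: untouched..|].
by apply: connect_trans (connect_ports ab _ _) (connect_copy _ _); apply: untouched.
Qed.

Lemma connected_subst_del : connected (del_vertices S).
Proof.
apply/connected_delP=> -[v x] [w y]; rewrite !in_setC.
move=> /connect_to_untouched[v' v'S vv'] /connect_to_untouched[w' w'S ww'].
apply: connect_trans vv' (connect_trans (connect_untouched v'S w'S) _).
by rewrite sym_connect_sym //; apply/avoid_sym/adj_sym.
Qed.

End Connectivity.

Lemma k_connected_subst k k2 :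
  k_connected k G -> k_connected k2 H -> k_connected (minn k k2) F.
Proof.
move=> connG connH; split=> [|S]; last first.
  by rewrite leq_min => /andP[]; apply: connected_subst_del connG connH.
rewrite card_subst (leq_ltn_trans (geq_minr _ _)) // (leq_trans connH.1) //.
by rewrite leq_pmull // (leq_ltn_trans _ connG.1).
Qed.

End Ports.
End Substitution.

(** * The infinite family *)

Lemma exists_girth (G : sgraph) (C : subgraph G) m :
  is_cycle C -> girth_ge G m -> exists2 g, has_girth G g & m <= g.
Proof.
move=> [c0 [c0_gt2 cyc0 _]] girth_m.
pose has_ucycle n := (2 < n) && [exists t : n.-tuple G, ucycleb (@adj G) t].
have has_ucycleP c : 2 < size c -> ucycle (@adj G) c -> has_ucycle (size c).
  by move=> c_gt2 cyc_c; rewrite /has_ucycle c_gt2; apply/existsP; exists (in_tuple c).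
have ex_ucycle : exists n, has_ucycle n by exists (size c0); apply: has_ucycleP.
have [g /andP[g_gt2 /existsP[t cyc_t]] min_g] := ex_minnP ex_ucycle.
have t_gt2 : 2 < size t by rewrite size_tuple.
have is_cycle_t : is_cycle (subgraph_of_seq t) by exists t.
have length_t : cycle_length (subgraph_of_seq t) = g.
  by have /andP[_ ut] := cyc_t; rewrite /cycle_length card_edges_seq // size_tuple.
exists g; last by rewrite -length_t; apply: girth_m.
split=> [|D [c [c_gt2 cyc_c ->]]]; first by exists (subgraph_of_seq t).
have /andP[_ uc] := cyc_c; rewrite /cycle_length card_edges_seq //.
exact: min_g (has_ucycleP c c_gt2 cyc_c).
Qed.

Lemma sgraph_iso_card (G1 G2 : sgraph) : sgraph_iso G1 G2 -> #|G1| = #|G2|.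
Proof. by case=> f bij_f _; apply: bij_eq_card bij_f. Qed.

Definition unique_longest_cubic (k g : nat) (G : sgraph) : Prop :=
  [/\ cubic G, k_connected k G, girth_ge G g & unique_longest_cycle G].

Lemma unique_longest_cubic_subst (G2 : sgraph) (u : G2)
    (x0 : del_vertices [set u]) ham (G : sgraph) (k g k2 g2 : nat) :
  cubic G2 -> girth_ge G2 g2 -> k_connected k2 (del_vertices [set u]) ->
  unique_hamiltonian_at u ham -> unique_longest_cubic k g G ->
  unique_longest_cubic (minn k k2) (minn (2 * g) g2) (subst_graph x0 G).
Proof.
move=> cub2 girth2 conn2 hamP [cub conn girth long].
have deg_eq v : #|nbh (@adj G) v| = #|nbh (@adj G2) u| by rewrite [LHS]cub [RHS]cub2.
split; first exact: cubic_subst deg_eq cub2.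
- exact: k_connected_subst.
- exact: girth_ge_subst.
- exact: unique_longest_subst hamP cub long.
Qed.

Lemma unique_longest_cubic_iter_subst (G2 : sgraph) (u : G2)
    (x0 : del_vertices [set u]) ham (G : sgraph) (k g k2 g2 n : nat) :
  cubic G2 -> girth_ge G2 g2 -> k_connected k2 (del_vertices [set u]) ->
  unique_hamiltonian_at u ham -> unique_longest_cubic k g G ->
  unique_longest_cubic (minn k k2) (minn (2 * g) g2) (iter n.+1 (subst_graph x0) G).
Proof.
move=> cub2 girth2 conn2 hamP goodG.
have subst_good := unique_longest_cubic_subst x0 cub2 girth2 conn2 hamP.
elim: n => [|n /subst_good[cub]]; first exact: subst_good.
rewrite -minnA minnn => conn girth long; split=> // C /girth; apply: leq_trans.
lia.
Qed.

Lemma card_iter_subst (G2 : sgraph) (u : G2) (x0 : del_vertices [set u])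
    (G : sgraph) n :
  #|iter n (subst_graph x0) G| = #|G| * #|del_vertices [set u]| ^ n.
Proof. by elim: n => [|n IH]; rewrite ?muln1 // card_subst IH -mulnA -expnSr. Qed.

Theorem mainTheorem1 (k1 k2 g1 g2 : nat)
    (k1_gt0 : 0 < k1) (k2_gt0 : 0 < k2) (g1_gt0 : 0 < g1) (g2_gt0 : 0 < g2)
    (exG1 : exists G1 : sgraph,
       [/\ cubic G1, k_connected k1 G1, has_girth G1 g1 &
           unique_longest_cycle G1])
    (exG2 : exists G2 : sgraph,
       [/\ cubic G2, has_girth G2 g2, num_hamiltonian_cycles G2 3 &
           exists u : G2, k_connected k2 (del_vertices [set u])]) :
  exists F : nat -> sgraph,
    (forall i j : nat, i <> j -> ~ sgraph_iso (F i) (F j)) /\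
    (forall i : nat,
       [/\ cubic (F i), k_connected (minn k1 k2) (F i),
           (exists2 g : nat, has_girth (F i) g & minn (2 * g1) g2 <= g) &
           unique_longest_cycle (F i)]).
Proof.
have [G1 [cub1 conn1 [_ girth1] long1]] := exG1.
have [G2 [cub2 [_ girth2] ham2 [u conn2]]] := exG2.
have [ham hamP] := three_hamiltonian_cycles_unique_at u cub2 ham2.
have /card_gt0P[x0 _] : 0 < #|del_vertices [set u]| by apply: leq_ltn_trans conn2.1.
pose F i := iter i.+1 (subst_graph x0) G1; exists F.
have F_good i : unique_longest_cubic (minn k1 k2) (minn (2 * g1) g2) (F i).
  exact: unique_longest_cubic_iter_subst cub2 girth2 conn2 hamP _.
split=> [i j neq_ij /sgraph_iso_card|i].
  have G1_gt0 : 0 < #|G1| by apply: leq_ltn_trans conn1.1.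
  have H_gt1 : 1 < #|del_vertices [set u]|.
    by rewrite (leq_trans _ (degree_le_card_del u)) // [#|_|]cub2.
  by rewrite !card_iter_subst => /eqP; rewrite eqn_pmul2l // eqn_exp2l // => /eqP[].
have [cubF connF girthF longF] := F_good i; split=> //.
by have [C [[cycC _] _]] := longF; apply: exists_girth cycC girthF.
Qed.
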